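(* Consider the quantized estimation system below, under the assumption that all partitioned observation subvectors $\{\mathbf{x}_{jl}\}$ are known to be independent and that there are only $W<\sum_j L_j$ distinct statistical models among them: the subvector indices using the $w$-th model $(\tilde{\mathscr{X}}_w,\tilde{\mathscr{F}}_w,\tilde{\mathscr{P}}_w^{\boldsymbol{\theta}})$ form group $\mathcal{A}_w$, which is split into $T_w$ disjoint nonempty subgroups $\mathcal{A}_w^{(t)}$ whose subvectors all use the same vector quantizer $\tilde\gamma_w^{(t)}$ with $\tilde R_w^{(t)}$ levels and regions $\{\tilde I_{wt}^{(r)}\}$. (i) Suppose the interior of $\boldsymbol{\Theta}\subset\mathbb{R}^{D_{\boldsymbol{\theta}}}$ is nonempty and every $q_j^{(\mathbf{s})}(\boldsymbol{\theta})$ is twice differentiable in $\boldsymbol{\theta}$ on $\boldsymbol{\Theta}$. Then for any $\boldsymbol{\theta}$, any quantization regions $\{\tilde I_{wt}^{(r)}\}$ and any statistical models $\{(\tilde{\mathscr{X}}_w,\tilde{\mathscr{F}}_w,\tilde{\mathscr{P}}_w^{\boldsymbol{\theta}})\}$, if $$D_{\boldsymbol{\theta}} > \lambda_{\text{Indep}}^{\text{ISM}}\big(\{\mathcal{A}_w^{(t)}\},\{\tilde R_w^{(t)}\}\big) := \sum_{w=1}^W\sum_{t=1}^{T_w}\big(\tilde R_w^{(t)}-1\big),$$ then the Fisher information matrix for estimating $\boldsymbol{\theta}$ is singular. (ii) Suppose the interior of $\boldsymbol{\Theta}$ is nonempty and every $q_j^{(\mathbf{s})}(\boldsymbol{\theta})$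 is continuous in $\boldsymbol{\theta}$. Then for any $\{\tilde I_{wt}^{(r)}\}$ and any $\{(\tilde{\mathscr{X}}_w,\tilde{\mathscr{F}}_w,\tilde{\mathscr{P}}_w^{\boldsymbol{\theta}})\}$, if the same inequality $D_{\boldsymbol{\theta}}>\lambda_{\text{Indep}}^{\text{ISM}}$ holds, the vector parameter space $\boldsymbol{\Theta}$ is not identifiable; moreover, every open subset $\mathcal{U}\subset\boldsymbol{\Theta}$ of $\mathbb{R}^{D_{\boldsymbol{\theta}}}$ contains infinitely many nonidentifiable vector parameter points.
   Context: System: $N$ sensors; sensor $j$ observes $\mathbf{x}_j$, independent across $j$, unknown $\boldsymbol{\theta}\in\boldsymbol{\Theta}\subset\mathbb{R}^{D_{\boldsymbol{\theta}}}$. $\mathbf{x}_j$ is partitioned into $L_j$ subvectors $\mathbf{x}_{jl}$, each quantized by an $R_{jl}$-level vector quantizer $\gamma_{jl}(\mathbf{x}_{jl})=\sum_r r\,\mathbb{1}\{\mathbf{x}_{jl}\in I_{jl}^{(r)}\}$ with disjoint covering regions; the superquantizer output $\mathbf{u}_j=\Gamma_j(\mathbf{x}_j)=[\gamma_{j1}(\mathbf{x}_{j1}),\dots,\gamma_{jL_j}(\mathbf{x}_{jL_j})]^T$ is sent error-free to a fusion center, which estimates $\boldsymbol{\theta}$ from $\mathbf{u}=[\mathbf{u}_1^T,\dots,\mathbf{u}_N^T]^T$. $q_j^{(\mathbf{s})}(\boldsymbol{\theta})=\mathscr{P}_j^{\boldsymbol{\theta}}(\Gamma_j(\mathbf{x}_j)=\mathbf{s})$,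 where $\mathscr{P}_j^{\boldsymbol{\theta}}$ is the law of $\mathbf{x}_j$. Fisher information matrix $\mathbf{J}(\boldsymbol{\theta})=\sum_j\sum_{\mathbf{s}}\frac{1}{q_j^{(\mathbf{s})}}\frac{\partial q_j^{(\mathbf{s})}}{\partial\boldsymbol{\theta}}\big[\frac{\partial q_j^{(\mathbf{s})}}{\partial\boldsymbol{\theta}}\big]^T$. Two distinct points are observationally equivalent if $\Pr(\mathbf{u}|\boldsymbol{\theta})=\Pr(\mathbf{u}|\boldsymbol{\theta}')$ for all $\mathbf{u}$; a point is identifiable if no other point is observationally equivalent to it; $\boldsymbol{\Theta}$ is identifiable if every point is. If indices of $\mathbf{x}_{j_1l_1}$ and $\mathbf{x}_{j_2l_2}$ lie in the same $\mathcal{A}_w^{(t)}$ then $\gamma_{j_1l_1}=\gamma_{j_2l_2}$. *)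

(* Defs.v *)
From HB Require Import structures.
From mathcomp Require Import all_boot all_order all_algebra.
From mathcomp Require Import all_classical all_reals all_analysis.
Set Implicit Arguments. Unset Strict Implicit. Unset Printing Implicit Defensive.
Import Order.TTheory GRing.Theory Num.Theory.
Import numFieldNormedType.Exports.
Local Open Scope classical_set_scope.
Local Open Scope ring_scope.

(* Quantized estimation system with independent subvectors and W identical
   statistical models (ISM).
   - sensors j : 'I_N, sensor j has L j subvectors l : 'I_(L j);
   - grp j l : 'I_W   is the model index w with (j,l) \in A_w;
   - sub j l : 'I_(T w) is the subgroup index t with (j,l) \in A_w^(t);
   - Rl w t           is the number of levels R~_w^(t) of quantizer gamma~_w^(t);
   - I w t r          is the quantization region I~_{wt}^(r)  (r : 'I_(Rl w t));
   - X w, P w theta   is the statistical model (X~_w, F~_w, P~_w^theta). *)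
Section ISM.
Context (R : realType) (D N : nat) (L : 'I_N -> nat) (W : nat)
  (T : 'I_W -> nat)
  (grp : forall j : 'I_N, 'I_(L j) -> 'I_W)
  (sub : forall (j : 'I_N) (l : 'I_(L j)), 'I_(T (grp j l)))
  (Rl : forall w : 'I_W, 'I_(T w) -> nat)
  (d : 'I_W -> measure_display) (X : forall w, measurableType (d w))
  (P : forall w : 'I_W, 'rV[R]_D -> probability (X w) R)
  (I : forall (w : 'I_W) (t : 'I_(T w)), 'I_(Rl w t) -> set (X w)).

Definition sensor_out (j : 'I_N) : finType :=
  {dffun forall l : 'I_(L j), 'I_(Rl (sub l))}.

Definition fusion_out : finType := {dffun forall j : 'I_N, sensor_out j}.

(* q_j^(s)(theta) = P_j^theta(Gamma_j(x_j) = s); by independence of the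
   subvectors x_jl this is the product of the marginal region probabilities. *)
Definition q (j : 'I_N) (s : sensor_out j) (theta : 'rV[R]_D) : R :=
  \prod_(l < L j) fine (P (grp l) theta (@I _ (sub l) (s l))).

(* Pr(u | theta), sensors independent. *)
Definition Pr_u (u : fusion_out) (theta : 'rV[R]_D) : R :=
  \prod_(j < N) q (u j) theta.

Definition partial (i : 'I_D) (f : 'rV[R]_D -> R) (theta : 'rV[R]_D) : R :=
  'D_(delta_mx 0 i) f theta.

(* Fisher information matrix J(theta) (with the MathComp convention 0^-1 = 0). *)
Definition FIM (theta : 'rV[R]_D) : 'M[R]_D :=
  \matrix_(a < D, b < D)
    \sum_(j < N) \sum_(s : sensor_out j)
      (q s theta)^-1 * partial a (q s) theta * partial b (q s) theta.

Definition obs_equiv (theta theta' : 'rV[R]_D) : Prop :=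
  forall u : fusion_out, Pr_u u theta = Pr_u u theta'.

Definition identifiable_pt (Theta : set 'rV[R]_D) (theta : 'rV[R]_D) : Prop :=
  forall theta', Theta theta' -> theta' <> theta -> ~ obs_equiv theta theta'.

Definition identifiable (Theta : set 'rV[R]_D) : Prop :=
  forall theta, Theta theta -> identifiable_pt Theta theta.

Definition lambda_ISM : nat := (\sum_(w < W) \sum_(t < T w) (Rl t - 1))%N.

Definition grouping_ok : Prop :=
  (W < \sum_(j < N) L j)%N /\
  (forall w, 0 < T w)%N /\
  (forall (w : 'I_W) (t : 'I_(T w)),
     exists (j : 'I_N) (l : 'I_(L j)),
       grp l = w /\ nat_of_ord (sub l) = nat_of_ord t).

Definition quantizers_ok : Prop :=
  forall (w : 'I_W) (t : 'I_(T w)),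
    (forall r, measurable (@I w t r)) /\
    (forall r r', r != r' -> @I w t r `&` @I w t r' = set0) /\
    (forall x : X w, exists r, @I w t r x).

End ISM.

(* Main.v *)
Require Import Defs.
From HB Require Import structures.
From mathcomp Require Import all_boot.
Set Implicit Arguments. Unset Strict Implicit. Unset Printing Implicit Defensive.

(** Everything the fusion center sees depends on theta only through the region
    probabilities, and after dropping one level per quantizer (the probabilities of
    its regions sum to 1) these form lambda_ISM functions of theta.

    (i) With D > lambda_ISM some direction v <> 0 annihilates the differentials of all
    region probabilities, hence of every q_j^(s), so v is in the kernel of the Fisher
    information matrix.

    (ii) A continuous map from an open set of R^D to R^m with m < D is not injective.
    If it were, then on a fine grid of a simplex two points whose images lie in the
    same brick of a fine partition of R^m would be close. The bricks can be coloured
    with m + 1 colours so that distinct bricks of one colour are well separated. Label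
    a grid point by a facet of the simplex that its brick nearly touches. A Sperner
    type lemma of Scarf produces pairwise close grid points carrying all D + 1 labels;
    two of these share a colour, hence a brick, hence a label. To find infinitely many
    nonidentifiable points, remove finitely many points from the open set first. *)

(** * Scarf's lemma *)

Lemma setU1_of_card (Y : finType) (D T : {set Y}) :
  D \subset T -> #|T| = #|D|.+1 -> exists2 x, x \notin D & T = x |: D.
Proof.
move=> sDT nT; have /cards1P [x TDx] : #|T :\: D| == 1.
  by rewrite cardsD (setIidPr sDT) nT subSnn.
have /setDP [xT xD] : x \in T :\: D by rewrite TDx set11.
exists x => //; rewrite -TDx; apply/setP => y; rewrite !inE.
by case: (boolP (y \in D)) => [/(subsetP sDT) ->|]; rewrite ?orbF.
Qed.

Section Scarf.
Variables (Y I : finType) (r : I -> Y -> nat) (a : I -> Y) (c : Y -> I).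
Hypothesis r_inj : forall i, injective (r i).
(* [a i] plays the role of the facet opposite to the vertex [i] of a simplex. *)
Hypothesis ca : forall i, c (a i) = i.
Hypothesis a_min : forall i y, r i (a i) <= r i y.
Hypothesis a_max : forall i k y, y \notin codom a -> k != i -> r i y < r i (a k).
Hypothesis I_gt1 : 1 < #|I|.

(** No point lies strictly above the minima of [T] in all orders at once; these are Scarf's
    primitive sets, of any size. *)
Definition dominant (T : {set Y}) : Prop :=
  forall y, exists i, forall s, s \in T -> r i y <= r i s.

Let dom (T : {set Y}) := [forall y, exists i, forall s in T, r i y <= r i s].

Let domP T : reflect (dominant T) (dom T).
Proof.
apply: (iffP 'forall_existsP) => H y; have [i Hi] := H y; exists i.
  by move=> s sT; exact: (implyP (forallP Hi s)).
by apply/forall_inP.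
Qed.

Let dom_sub (T T' : {set Y}) : T' \subset T -> dominant T -> dominant T'.
Proof.
by move=> /subsetP sT domT y; have [i Hi] := domT y; exists i => s /sT; apply: Hi.
Qed.

Variable i0 : I.

(* Scarf's parity argument: a room without all labels has an even number of doors,
   and every door lies in exactly two rooms, except for the door [D0] at the boundary
   of the simplex, which lies in only one. *)
Let door D := dom D && ((c @: D == [set~ i0]) && (#|D| == #|I|.-1)).
Let room T := dom T && (#|T| == #|I|).
Let D0 := a @: [set~ i0].

Let cardC1 (i : I) : #|[set~ i]| = #|I|.-1.
Proof. by rewrite cardsC1. Qed.

Let door_inj D : door D -> {in D &, injective c}.
Proof.
case/andP=> _ /andP [/eqP cD /eqP nD]; apply/imset_injP.
by rewrite cD nD cardC1.
Qed.

(** If the room contains a door, exactly one label occurs twice in it, and its doors arise by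
    removing either of the two points with that label. *)
Let room_doors T : (forall T', room T' -> c @: T' != setT) -> room T ->
  ~~ odd #|[set D | door D && (D \subset T)]|.
Proof.
move=> nrainbow rT; have /andP [/domP dT /eqP nT] := rT.
have [->|[D]] := set_0Vmem [set D | door D && (D \subset T)].
  by rewrite cards0.
rewrite inE => /andP [dD sDT]; have /andP [_ /andP [/eqP cD /eqP nD]] := dD.
have [x xD TE] : exists2 x, x \notin D & T = x |: D.
  by apply: setU1_of_card => //; rewrite nT nD prednK // ltnW.
have xT : x \in T by rewrite TE setU11.
have cx : c x != i0.
  apply: contra (nrainbow T rT) => /eqP cx.
  by rewrite TE imsetU1 cD cx setUCr.
have : c x \in c @: D by rewrite cD !inE.
case/imsetP=> x' x'D cxx'.
have xx' : x != x' by apply: contraNneq xD => ->.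
have nTx' : #|T :\ x'| = #|I|.-1.
  by have := cardsD1 x' T; rewrite nT (subsetP sDT _ x'D) => ->.
have -> : [set D | door D && (D \subset T)] = [set D; T :\ x'].
  apply/setP => E; rewrite !inE; apply/andP/orP => [[dE sET]|].
    have nE : #|E| = #|I|.-1 by have /andP [_ /andP [_ /eqP]] := dE.
    have [xE|xE] := boolP (x \in E); [right|left].
      rewrite eqEcard nE nTx' leqnn andbT; apply/subsetP => z zE.
      rewrite !inE (subsetP sET _ zE) andbT; apply: contraNneq xx' => zx'.
      by rewrite (door_inj dE xE _ cxx') // -zx'.
    rewrite eqEcard nE nD leqnn andbT; apply/subsetP => z zE.
    have := subsetP sET _ zE; rewrite TE !inE => /orP [/eqP zx|//].
    by rewrite -zx zE in xE.
  case=> [/eqP ->//|/eqP ->]; split; last exact: subsetDl.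
  rewrite /door nTx' eqxx andbT; apply/andP; split.
    by apply/domP; apply: dom_sub dT; exact: subsetDl.
  rewrite -cD; apply/eqP/setP => k; apply/imsetP/imsetP => [[z]|[z zD kz]].
    rewrite !inE TE !inE => /andP [zx' /orP [/eqP ->|zD] ->].
      by exists x'.
    by exists z.
  have [zx'|zx'] := eqVneq z x'.
    by exists x; rewrite ?inE ?xx' // kz zx' cxx'.
  by exists z; rewrite // !inE zx' TE !inE zD orbT.
rewrite cards2; suff -> : D != T :\ x' by [].
by apply: contraNneq xD => ->; rewrite !inE xx'.
Qed.

Section Door.
Variable D : {set Y}.
Hypothesis dD : door D.

Let domD : dominant D. Proof. by have /andP [/domP] := dD. Qed.
Let cardD : #|D| = #|I|.-1.
Proof. by have /andP [_ /andP [_ /eqP]] := dD. Qed.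
Let D_gt0 : 0 < #|D|.
Proof. by rewrite cardD -subn1 subn_gt0. Qed.

Lemma door_min_exists i : exists y, y \in D /\ forall s, s \in D -> r i y <= r i s.
Proof.
have /card_gt0P [y yD] := D_gt0.
by case: (arg_minnP (r i) yD) => z zD Hz; exists z.
Qed.

Variable mn : I -> Y.
Hypothesis mnP : forall i, mn i \in D /\ forall s, s \in D -> r i (mn i) <= r i s.

Lemma door_min_unique i s : s \in D -> (forall s', s' \in D -> r i s <= r i s') -> s = mn i.
Proof.
move=> sD Hs; have [mD Hm] := mnP i; apply: (@r_inj i).
by apply/eqP; rewrite eqn_leq Hs //= Hm.
Qed.

(** Dominance tested at a point of [D] makes that point a minimum of [D] in some order. *)
Let mn_im : mn @: setT = D.
Proof.
apply/setP => s; apply/imsetP/idP => [[i _ ->]|sD]; first by case: (mnP i).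
by have [i Hi] := domD s; exists i; rewrite ?inE //; apply: door_min_unique.
Qed.

(** Candidates for replacing the bound that [D] puts on the order [j]. *)
Let M j := [set y | [forall (i | i != j), r i (mn i) < r i y]].
Let MP j y : reflect (forall i, i != j -> r i (mn i) < r i y) (y \in M j).
Proof. by rewrite inE; exact: forall_inP. Qed.

(* A door has one point less than there are orders, so some point is minimal for two
   of them; replacing the bound given by one of the two, and then by the other, yields
   the two rooms of the door. *)
Variables (j k : I).
Hypotheses (jk : j != k) (mjk : mn j = mn k).

Let mn_imC1 i : (i == j) || (i == k) -> mn @: [set~ i] = D.
Proof.
move=> ijk; apply/eqP; rewrite eqEsubset -{1}mn_im imsetS ?subsetT //=.
rewrite -mn_im; apply/subsetP => _ /imsetP [l _ ->].
have [li|li] := eqVneq l i; last by rewrite imset_f // !inE.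
rewrite li; case/orP: ijk => /eqP ->.
  by rewrite mjk imset_f // !inE eq_sym.
by rewrite -mjk imset_f // !inE.
Qed.

(** Since [j] and [k] differ, such a point would exceed the minima of [D] in all orders, against
    dominance. *)
Let M_disj x : x \in M j -> x \in M k -> False.
Proof.
move=> /MP xj /MP xk; have [i Hi] := domD x.
have {Hi} := Hi _ (mnP i).1; rewrite leqNgt => /negP; apply.
have [ij|ij] := eqVneq i j; last exact: xj.
by apply: xk; rewrite ij.
Qed.

(** The first candidate met when the bound in the order [l] is lowered. *)
Let top l x := (x \in M l) && [forall y in M l, r l y <= r l x].

(** Every point of [D] is the minimum in an order other than [l], where [x] is larger, so [x] is
    new. Adding it changes only the bound in the order [l], to a value that no point of [M l]
    exceeds. *)
Let top_dom l x : (l == j) || (l == k) -> top l x ->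
  (x \notin D) /\ dominant (x |: D).
Proof.
move=> ljk /andP [/MP xM /forall_inP xmax]; split.
  apply/negP; rewrite -(mn_imC1 ljk) => /imsetP [i]; rewrite !inE => il xi.
  by have := xM i il; rewrite -xi ltnn.
move=> y; have [yM|] := boolP (y \in M l).
  exists l => s /setU1P [->|sD]; first exact: xmax.
  apply: leq_trans (xmax _ yM) _.
  have [i Hi] := domD x; have [il|il] := eqVneq i l.
    by rewrite -il; exact: Hi.
  by have := Hi _ (mnP i).1; rewrite leqNgt xM.
rewrite inE => /forall_inPn [i il]; rewrite -leqNgt => yi.
exists i => s /setU1P [->|sD].
  by apply: leq_trans yi _; apply: ltnW; exact: xM.
by apply: leq_trans yi _; case: (mnP i) => _; apply.
Qed.

(** Each point of [D] is minimal in an order where [x] is strictly above it, and [x] is minimal in a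
    further order [i1]. Counting makes [mn] injective away from [i1], so [i1] is [j] or [k]. *)
Let dom_top x : x \notin D -> dominant (x |: D) -> top j x || top k x.
Proof.
move=> xD domT.
have [i1 Hi1] := domT x.
pose A := [set i | r i (mn i) < r i x].
have i1A : i1 \notin A.
  by rewrite inE -leqNgt; apply: Hi1; rewrite inE (mnP i1).1 orbT.
have DA : D \subset mn @: A.
  apply/subsetP => s sD; have [i Hi] := domT s.
  have smn : s = mn i.
    by apply: door_min_unique => // s' s'D; apply: Hi; rewrite inE s'D orbT.
  rewrite smn imset_f // inE ltn_neqAle -smn Hi ?setU11 // andbT.
  by apply: contraNneq xD => /r_inj <-.
have nA : #|I|.-1 <= #|A|.
  by rewrite -cardD (leq_trans (subset_leq_card DA)) // leq_imset_card.
have AE : A = [set~ i1].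
  apply/eqP; rewrite eqEcard cardC1 nA andbT.
  by apply/subsetP => i iA; rewrite !inE; apply: contraNneq i1A => <-.
have mninj : {in A &, injective mn}.
  apply/imset_injP; rewrite eqn_leq leq_imset_card /= {1}AE cardC1 -cardD.
  exact: subset_leq_card.
have i1jk : (i1 == j) || (i1 == k).
  apply: contraR jk; rewrite negb_or => /andP [i1j i1k]; apply/eqP.
  by apply: mninj => //; rewrite AE !inE eq_sym.
have ti1 : top i1 x.
  have xM : x \in M i1.
    by apply/MP => i ii1; have : i \in A by [rewrite AE !inE]; rewrite inE.
  rewrite /top xM; apply/forall_inP => y /MP yM.
  have [i Hi] := domT y.
  have [ii1|ii1] := eqVneq i i1; first by rewrite -ii1; apply: Hi; exact: setU11.
  by have := yM _ ii1; rewrite ltnNge Hi // inE (mnP i).1 orbT.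
by case/orP: i1jk ti1 => /eqP -> ->; rewrite ?orbT.
Qed.

Let top_uniq l x y : top l x -> top l y -> x = y.
Proof.
move=> /andP [xM /forall_inP xm] /andP [yM /forall_inP ym].
by apply: (@r_inj l); apply/eqP; rewrite eqn_leq ym ?xm.
Qed.

Let top_ex l y : y \in M l -> exists x, top l x.
Proof.
move=> yM; case: (arg_maxnP (r l) yM) => x xM Hx; exists x.
by apply/andP; split=> //; apply/forall_inP.
Qed.

Let tops := [set x | top j x || top k x].

Let rooms_tops : #|[set T | room T && (D \subset T)]| = #|tops|.
Proof.
have -> : [set T | room T && (D \subset T)] = (fun x => x |: D) @: tops.
  apply/setP => T; rewrite inE; apply/andP/imsetP => [[rT sDT]|[x]].
    have /andP [/domP dT /eqP nT] := rT.
    have [x xD TE] : exists2 x, x \notin D & T = x |: D.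
      by apply: setU1_of_card => //; rewrite nT cardD prednK // ltnW.
    by exists x => //; rewrite inE; apply: dom_top => //; rewrite -TE.
  rewrite inE => tx ->; split; last exact: subsetUr.
  have [xD dT] : x \notin D /\ dominant (x |: D).
    by case/orP: tx => tx; apply: top_dom tx; rewrite eqxx ?orbT.
  rewrite /room cardsU1 xD cardD add1n prednK ?eqxx ?andbT; last exact: ltnW.
  exact/domP.
apply: card_in_imset => x y; rewrite !inE => tx ty xyD.
have xD : x \notin D.
  by case/orP: tx => tx; case: (top_dom _ tx); rewrite ?eqxx ?orbT.
have : x \in y |: D by rewrite -xyD setU11.
by rewrite inE (negbTE xD) orbF inE => /eqP.
Qed.

(** Both candidate sets are inhabited, so either bound can be replaced, and [M_disj] makes the two
    rooms different. *)
Lemma rooms_even (yj yk : Y) :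
  (forall i, i != j -> r i (mn i) < r i yj) ->
  (forall i, i != k -> r i (mn i) < r i yk) ->
  ~~ odd #|[set T | room T && (D \subset T)]|.
Proof.
move=> /MP /top_ex [x tx] /MP /top_ex [y ty]; rewrite rooms_tops.
have -> : tops = [set x; y].
  apply/setP => z; rewrite !inE; apply/orP/orP => [[tz|tz]|[/eqP ->|/eqP ->]].
  - by left; rewrite (top_uniq tz tx).
  - by right; rewrite (top_uniq tz ty).
  - by left.
  - by right.
rewrite cards2; suff -> : x != y by [].
apply/eqP => xy; case/andP: tx ty => xM _ /andP [yM _].
by apply: (@M_disj x) => //; rewrite xy.
Qed.

(** Here [M k] is empty, so only the bound in the order [j] can be replaced: the door lies on the
    boundary. *)
Lemma rooms_odd y :
  (forall i, i != j -> r i (mn i) < r i y) ->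
  (forall z, ~ forall i, i != k -> r i (mn i) < r i z) ->
  odd #|[set T | room T && (D \subset T)]|.
Proof.
move=> /MP /top_ex [x tx] Mk; rewrite rooms_tops.
have -> : tops = [set x]; last by rewrite cards1.
apply/setP => z; rewrite !inE; apply/orP/eqP => [[tz|]|->]; last by left.
  exact: top_uniq tz tx.
by case/andP => /MP /Mk.
Qed.
End Door.

Variable y0 : Y.
Hypothesis y0_art : y0 \notin codom a.

Let a_inj : injective a.
Proof. exact: can_inj ca. Qed.

Let cardD0 : #|D0| = #|I|.-1.
Proof. by rewrite card_imset ?cardC1. Qed.

Let door_D0 : door D0.
Proof.
apply/andP; split; last first.
  rewrite cardD0 eqxx andbT; apply/eqP/setP => i.
  apply/imsetP/idP => [[_ /imsetP [l li ->] ->]|i_i0]; first by rewrite ca.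
  by exists (a i); rewrite ?ca ?imset_f.
apply/domP => y; have [/codomP [m ->]|yart] := boolP (y \in codom a).
  by exists m => s _; exact: a_min.
exists i0 => s /imsetP [l]; rewrite !inE => li ->.
by apply: ltnW; exact: a_max.
Qed.

(** Two orders share a minimum, as there are fewer points than orders. A door with a non-artificial
    point has artificial candidates for both orders; a purely artificial door is [D0] by its
    labels. *)
Let door_rooms D : door D -> odd #|[set T | room T && (D \subset T)]| = (D == D0).
Proof.
move=> dD; have /andP [/domP domD /andP [/eqP cD /eqP nD]] := dD.
have [mn mnP] := fin_all_exists (door_min_exists dD).
have /injectivePn [j [k jk mjk]] : ~~ injectiveb mn.
  apply/injectiveP => inj; have := card_imset setT inj; rewrite cardsT => mnI.
  have : #|mn @: setT| <= #|D|.
    by apply: subset_leq_card; apply/subsetP => _ /imsetP [i _ ->]; case: (mnP i).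
  by rewrite mnI nD leqNgt ltn_predL ltnW.
have [Da|/subsetPn [s sD sart]] := boolP (D \subset codom a); last first.
  have aM l i : i != l -> r i (mn i) < r i (a l).
    move=> il; apply: leq_ltn_trans ((mnP i).2 _ sD) _.
    by apply: a_max; rewrite 1?eq_sym.
  rewrite (negbTE (rooms_even dD mnP jk mjk (aM j) (aM k))).
  by apply/esym/eqP => DE; move: sart; rewrite DE in sD;
    case/imsetP: sD => l _ ->; rewrite codom_f.
have DE : D = D0.
  apply/eqP; rewrite eqEcard nD cardD0 leqnn andbT; apply/subsetP => s sD.
  have /codomP [l sl] := subsetP Da _ sD.
  by rewrite sl imset_f // -cD; apply/imsetP; exists s; rewrite // sl ca.
rewrite DE eqxx -DE.
have mna i : i != i0 -> mn i = a i.
  move=> ii0; apply/esym/(door_min_unique mnP) => [|s' _]; last exact: a_min.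
  by rewrite DE imset_f ?inE.
(* The point [y0] is a candidate for [i0]. One for [l] would exceed [a l] in the order [i0], hence
   be another artificial point, which is least in its own order. *)
have odd_case l : l != i0 -> mn i0 = mn l ->
    odd #|[set T | room T && (D \subset T)]|.
  move=> li0 ml; have i0l : i0 != l by rewrite eq_sym.
  apply: (rooms_odd dD mnP i0l ml (y := y0)) => [i ii0|z Hz].
    rewrite mna // ltn_neqAle a_min andbT.
    by apply: contraNneq y0_art => /r_inj <-; rewrite codom_f.
  have := Hz _ i0l; rewrite ml mna // => alz.
  have [/codomP [m zm]|zart] := boolP (z \in codom a); last first.
    by have := a_max zart li0; rewrite ltnNge ltnW.
  have [ml'|/Hz] := eqVneq m l; first by rewrite zm ml' ltnn in alz.
  by rewrite zm ltnNge a_min.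
have [ji0|ji0] := eqVneq j i0.
  by apply: (odd_case k); rewrite -?ji0 1?eq_sym.
have [ki0|ki0] := eqVneq k i0; first by apply: (odd_case j); rewrite -?ki0.
by move: mjk jk; rewrite !mna // => /a_inj ->; rewrite eqxx.
Qed.

(** Otherwise the pairs of a door inside a room, counted modulo 2, give 0 room by room and 1 door by
    door. *)
Lemma scarf : exists2 T, dominant T & c @: T = setT.
Proof.
suff /existsP [T /andP [/andP [/domP dT _] /eqP cT]] :
    [exists T, room T && (c @: T == setT)] by exists T.
apply: contraT => /existsPn noT.
have nrb T : room T -> c @: T != setT by move=> rT; have := noT T; rewrite rT.
have cnt (p e : pred {set Y}) : #|[set T | p T && e T]| = \sum_(T | p T) e T.
  by rewrite cardsE -sum1_card big_mkcondr; apply: eq_bigr => T _; case: (e T).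
have cntT (D : {set Y}) : #|[set T | room T && (D \subset T)]| =
    \sum_(T | room T) (D \subset T) := cnt _ _.
have cntD (T : {set Y}) : #|[set D | door D && (D \subset T)]| =
    \sum_(D | door D) (D \subset T) := cnt _ _.
have : odd (\sum_(T | room T) \sum_(D | door D) (D \subset T)) =
       odd (\sum_(D | door D) \sum_(T | room T) (D \subset T)).
  by rewrite exchange_big.
rewrite !(big_morph odd oddD (erefl : odd 0 = false)) big1 => [|T rT]; last first.
  by apply/negbTE; rewrite -cntD; exact: room_doors.
rewrite (bigD1 D0) //= [X in _ (+) X]big1 ?addbF => [|D /andP [dD nD]].
  by rewrite -cntT door_rooms ?eqxx.
by rewrite -cntT door_rooms // (negbTE nD).
Qed.
End Scarf.

(** * A discrete covering theorem *)

Definition grid_simplex (I : finType) (N : nat) :=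
  {x : {ffun I -> 'I_N.+1} | \sum_i (x i : nat) == N}.

Definition grid_coord I N (x : grid_simplex I N) (i : I) : nat := val x i.

Lemma grid_coord_sum I N (x : grid_simplex I N) : \sum_i grid_coord x i = N.
Proof. exact/eqP/(valP x). Qed.

Section Grid.
Variables (I : finType) (N m B : nat) (V : eqType).
Local Notation X := (grid_simplex I N).
Local Notation n := #|I|.
Local Notation crd := (@grid_coord I N).
Variables (cls : X -> V) (col : V -> 'I_m).
Hypothesis I_gt1 : 1 < n.
Hypothesis m_lt : m < n.

Let grid_above (t : I -> nat) : \sum_i t i <= N -> exists x, forall i, t i <= crd x i.
Proof.
move=> tN; have /card_gt0P [i1 _] : 0 < n by exact: ltnW.
pose z i := t i + (i == i1) * (N - \sum_i t i).
have zN : \sum_i z i = N.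
  rewrite big_split /= [X in _ + X](bigD1 i1) //= eqxx mul1n.
  by rewrite [X in _ + (_ + X)]big1 ?addn0 ?subnKC // => i /negbTE ->.
have zle i : z i < N.+1 by rewrite ltnS -zN (bigD1 i) //= leq_addr.
pose x := [ffun i => Ordinal (zle i)].
have xN : \sum_i (x i : nat) == N.
  by apply/eqP; rewrite -[RHS]zN; apply: eq_bigr => i _; rewrite ffunE.
by exists (exist _ x xN) => i; rewrite /grid_coord /= ffunE /= leq_addr.
Qed.

Let sum0_le : \sum_(i : I) 0 <= N.
Proof. by rewrite big1. Qed.

Let Y := (X + I)%type.
(* The [i]-th coordinate with ties broken by [enum_rank]; an artificial point [inr k]
   is the least one for the order [k] and above the grid for the other orders. *)
Let rk (i : I) (y : Y) : nat :=
  match y with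
  | inl x => (crd x i * #|{: X}| + enum_rank x).+1
  | inr k => if k == i then 0 else (N.+1 * #|{: X}| + enum_rank k).+1
  end.

Let rk_lt i x x' : crd x i < crd x' i -> rk i (inl x) < rk i (inl x').
Proof.
move=> lt; rewrite /= ltnS; apply: (@leq_trans (crd x' i * #|{: X}|)); last exact: leq_addr.
apply: leq_trans (_ : (crd x i).+1 * #|{: X}| <= _); last by rewrite leq_mul2r lt orbT.
by rewrite mulSn addnC ltn_add2r.
Qed.

Let rk_top i k x : k != i -> rk i (inl x) < rk i (inr k).
Proof.
move=> /negbTE ki; rewrite /= ki ltnS.
apply: (@leq_trans (N.+1 * #|{: X}|)); last exact: leq_addr.
apply: leq_trans (_ : (crd x i).+1 * #|{: X}| <= _); last by rewrite leq_mul2r ltn_ord orbT.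
by rewrite mulSn addnC ltn_add2r.
Qed.

Let rk_inj i : injective (rk i).
Proof.
have neq x k : rk i (inl x) <> rk i (inr k).
  have [->|ki] := eqVneq k i; first by rewrite /= eqxx.
  by move=> e; have := rk_top x ki; rewrite e ltnn.
move=> [x|k] [x'|k'] e.
- congr inl; have [lt|lt|xx'] := ltngtP (crd x i) (crd x' i).
  + by have := rk_lt lt; rewrite e ltnn.
  + by have := rk_lt lt; rewrite e ltnn.
  + by move: e => /= [/eqP]; rewrite xx' eqn_add2l => /eqP/ord_inj/enum_rank_inj.
- by case: (neq _ _ e).
- by case: (neq _ _ (esym e)).
- move: e => /=; have [->|ki] := eqVneq k i; have [->|ki'] := eqVneq k' i => //.
  by move=> [/eqP]; rewrite eqn_add2l => /eqP/ord_inj/enum_rank_inj ->.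
Qed.

Section Near.
(** [S] will be the grid points of a dominant set, and [C] the orders whose artificial point is not
    in it. *)
Variables (S : {set X}) (C : {set I}).
Hypothesis domSC :
  forall x, exists2 i, i \in C & forall s, s \in S -> rk i (inl x) <= rk i (inl s).

(* If the thresholds summed to at most [N], a grid point above all of them would
   contradict dominance. *)
Let threshold : exists t : I -> nat, N < \sum_i t i /\
  forall i, (forall s, s \in S -> t i <= (crd s i).+1) /\ (i \notin C -> t i = 0).
Proof.
have [S0|[s0 s0S]] := set_0Vmem S.
  exists (fun i => if i \in C then N.+1 else 0); split; last first.
    by move=> i; split=> [s|/negbTE -> //]; rewrite S0 inE.
  have [x _] := grid_above (t := fun=> 0) sum0_le.
  by have [i iC _] := domSC x; rewrite (bigD1 i) //= iC leq_addr.
have ex i : exists t, [/\ forall s, s \in S -> t <= (crd s i).+1,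
    i \notin C -> t = 0 & i \in C -> exists2 s, s \in S & t = (crd s i).+1].
  have [iC|iC] := boolP (i \in C); last by exists 0.
  case: (arg_minnP (fun s => crd s i) s0S) => s sS Hs.
  by exists (crd s i).+1; split=> // _; exists s.
have [t tP] := fin_all_exists ex; exists t; split; last first.
  by move=> i; case: (tP i).
rewrite ltnNge; apply/negP => /grid_above [x tx].
have [i iC Hi] := domSC x; have [_ _ /(_ iC) [s sS ts]] := tP i.
have : crd s i < crd x i by rewrite -ts.
by move=> /rk_lt; rewrite ltnNge Hi.
Qed.

(** The numbers [(crd s j).+1] sum to [N + n] and the thresholds to more than [N], so the
    nonnegative gaps add up to less than [n]. *)
Let slack : exists t : I -> nat, forall i,
  (forall s, s \in S -> t i <= (crd s i).+1 < t i + n) /\ (i \notin C -> t i = 0).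
Proof.
have [t [tN tP]] := threshold; exists t => i; split=> [s sS|]; last exact: (tP i).2.
have le j : t j <= (crd s j).+1 by apply: (tP j).1.
rewrite le /= -ltn_subLR //.
have : \sum_j ((crd s j).+1 - t j) < n.
  rewrite sumnB //; under eq_bigr do rewrite -addn1.
  rewrite big_split /= grid_coord_sum sum1_card ltn_subLR ?ltn_add2r //.
  rewrite -sum1_card -(grid_coord_sum s) -big_split leq_sum // => j _.
  by rewrite /= ?(addn1, add1n).
by apply: leq_ltn_trans; rewrite (bigD1 i) //= leq_addr.
Qed.

Lemma dominated_near s s' i : s \in S -> s' \in S -> crd s i < crd s' i + n.
Proof.
move=> sS s'S; have [t tP] := slack; have [ts _] := tP i.
have /andP [_ lt] := ts _ sS; have /andP [le _] := ts _ s'S.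
by rewrite -ltnS -addSn; apply: leq_trans lt _; rewrite leq_add2r.
Qed.

Lemma dominated_facet s i : s \in S -> i \notin C -> crd s i < n.
Proof.
move=> sS iC; have [t tP] := slack; have [ts t0] := tP i.
by have := ts _ sS; rewrite t0 // add0n; exact: ltnW.
Qed.
End Near.

Hypothesis near_cls : forall x x',
  (forall i, crd x i <= crd x' i + n) -> (forall i, crd x' i <= crd x i + n) ->
  col (cls x) = col (cls x') -> cls x = cls x'.
Hypothesis cls_bound : forall x x', cls x = cls x' -> forall i, crd x i <= crd x' i + B.
Hypothesis N_big : n * (n + n + B) < N.

Let touches x i := [exists x', (cls x' == cls x) && (crd x' i <= n)].

Variable i0 : I.
(** The default [i0] goes to classes that touch no facet. *)
Let lab x := odflt i0 [pick i | touches x i].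

Let lab_cls x x' : cls x = cls x' -> lab x = lab x'.
Proof.
by move=> e; rewrite /lab (@eq_pick _ (touches x) (touches x')) // => i; rewrite /touches e.
Qed.

(** A discrete form of Lebesgue's covering theorem: fewer than [n] colours cannot cut the simplex
    into bounded pieces with pieces of one colour kept apart. *)
Lemma lebesgue_grid : False.
Proof.
have [x0 _] := grid_above (t := fun=> 0) sum0_le.
pose c (y : Y) := match y with inl x => lab x | inr i => i end.
have amin i y : rk i (inr i) <= rk i y by rewrite /= eqxx.
have amax i k (y : Y) : y \notin codom inr -> k != i -> rk i y < rk i (inr k).
  by case: y => [x _|l]; [exact: rk_top|rewrite codom_f].
have y0art : inl x0 \notin codom (@inr X I) by apply/negP => /codomP [].
have [T domT cT] := @scarf _ _ rk inr c rk_inj (fun=> erefl) amin amax I_gt1 i0 _ y0art.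
pose S := [set x | inl x \in T]; pose C := [set i | inr i \notin T].
have domSC x : exists2 i, i \in C & forall s, s \in S -> rk i (inl x) <= rk i (inl s).
  have [i Hi] := domT (inl x); exists i => [|s]; last by rewrite inE => /Hi.
  by rewrite inE; apply/negP => /Hi; rewrite /= eqxx.
have SC k : k \in C -> exists x, x \in S /\ lab x = k.
  have : k \in c @: T by rewrite cT.
  case/imsetP => [[x|i]] yT /= ->; last by rewrite inE yT.
  by exists x; rewrite inE.
have nearS x x' : x \in S -> x' \in S -> forall i, crd x i <= crd x' i + n.
  by move=> xS x'S i; exact/ltnW/(dominated_near domSC).
(* Without artificial points in [T] there are [n] close grid points with distinct labels, for only
   [m] colours. *)
have [CT|/subsetPn [i1 _ i1C]] := boolP (setT \subset C).
  have /fin_all_exists [s sP] i : exists x, x \in S /\ lab x = i.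
    by apply: SC; apply: (subsetP CT).
  have inj : injective (fun i => col (cls (s i))).
    move=> i j e; rewrite -(sP i).2 -(sP j).2; apply/lab_cls/near_cls => //;
      by apply: nearS; case: (sP i); case: (sP j).
  by have := leq_card _ inj; rewrite card_ord leqNgt m_lt.
(* The artificial point of [i1] is in [T], so all of [S] is within [n] of the facet [i1] and no
   label is a default. *)
have touched s : s \in S -> touches s (lab s).
  move=> sS; rewrite /lab; case: pickP => //= /(_ i1) /existsP []; exists s.
  by rewrite eqxx ltnW //; exact: (dominated_facet domSC).
have [k0 /SC [s [sS _]] _] := domSC x0.
(* A single grid point is close to every facet: either [k] is outside [C], or a nearby point of [S]
   has a class touching the facet [k]. *)
have bd k : crd s k <= n + n + B.
  have [kC|kC] := boolP (k \in C); last first.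
    by apply: (leq_trans (ltnW (dominated_facet domSC sS kC))); rewrite -addnA leq_addr.
  have [s' [s'S labk]] := SC _ kC.
  have /existsP [x' /andP [/eqP e le]] := touched _ s'S.
  rewrite labk in le; apply: leq_trans (nearS _ _ sS s'S k) _.
  rewrite addnAC leq_add2r; apply: leq_trans (cls_bound (esym e) k) _.
  by rewrite leq_add2r.
have := N_big; rewrite ltnNge => /negP; apply.
by rewrite -{1}(grid_coord_sum s) -sum_nat_const leq_sum.
Qed.
End Grid.

(** * Bricks *)

From mathcomp Require Import all_order all_algebra.
From mathcomp Require Import all_classical all_reals all_analysis.
From mathcomp Require Import zify ring lra.
Import Order.TTheory GRing.Theory Num.Theory.
Import numFieldNormedType.Exports.
Local Open Scope classical_set_scope.
Local Open Scope ring_scope.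

(** Between consecutive integers the quotient changes only if the larger one is a multiple of
    [M]. *)
Lemma divz_step (M u u' : int) : 0 < M -> u <= u' + 1 -> u' <= u + 1 ->
  ~~ (M %| u)%Z -> ~~ (M %| u')%Z -> (u %/ M)%Z = (u' %/ M)%Z.
Proof.
have key (v : int) : 0 < M -> ~~ (M %| v + 1)%Z -> ((v + 1) %/ M)%Z = (v %/ M)%Z.
  move=> M0 nd; have Mn0 : M != 0 by rewrite gt_eqF.
  have := divz_eq v M; have := modz_ge0 v Mn0; have := ltz_pmod v M0.
  set k := (v %/ M)%Z; set r := (v %% M)%Z => rM r0 vE.
  have [rM1|rM1] := eqVneq (r + 1) M.
    by case/negP: nd; apply/dvdzP; exists (k + 1); rewrite vE mulrDl mul1r -addrA rM1.
  rewrite vE -addrA divzMDl // divz_small ?addr0 //.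
  by rewrite gtz0_abs //; lia.
move=> M0 h1 h2 d d'.
have [->//|[e|e]] : u = u' \/ u = u' + 1 \/ u' = u + 1 by lia.
  by rewrite e key // -e.
by rewrite e key // -e.
Qed.

Section Bricks.
Variables (J : finType).
Let M := #|J|.+1.

(** The [z j] occupy at most [#|J|] of the [M] residues. *)
Lemma colour_exists (z : J -> int) : exists c : 'I_M, forall j, ~~ (M %| z j - c%:Z)%Z.
Proof.
pose res j : 'I_M := inord `|(z j %% M)%Z|%N.
have /subsetPn [c _ cres] : ~~ ('I_M \subset codom res).
  apply/negP => /subset_leq_card; rewrite card_ord leqNgt ltnS.
  by rewrite (leq_trans (card_size _)) // size_codom.
exists c => j; apply: contra cres => dv; apply/codomP; exists j.
apply: val_inj; rewrite /= inordK.
  have /eqP -> : (z j == c%:Z %[mod M])%Z by rewrite eqz_mod_dvd.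
  by rewrite modz_nat absz_nat modn_small.
by rewrite -ltz_nat gez0_abs ?modz_ge0 // ltz_pmod.
Qed.

Variable (z : J -> int).
(* A colour [c] for which no [z j] is congruent to [c] modulo [M]: the points with this
   property form boxes that are separated by the hyperplanes they avoid. *)
Definition brick_colour : 'I_M := projT1 (cid (colour_exists z)).
Definition brick : 'I_M * {ffun J -> int} :=
  (brick_colour, [ffun j => ((z j - brick_colour%:Z) %/ M)%Z]).
Lemma brick_colourP j : ~~ (M %| z j - brick_colour%:Z)%Z.
Proof. exact: (projT2 (cid (colour_exists z))). Qed.
End Bricks.

(** An integer step of length at most 1 cannot pass a hyperplane of the common colour without having
    an endpoint on it. *)
Lemma brick_close (J : finType) (z z' : J -> int) :
  (forall j, z j <= z' j + 1) -> (forall j, z' j <= z j + 1) ->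
  (brick z).1 = (brick z').1 -> brick z = brick z'.
Proof.
rewrite /brick /= => h h' e; congr pair => //; apply/ffunP => j; rewrite !ffunE.
apply: divz_step => //; rewrite ?brick_colourP //.
  by rewrite e; have := h j; lia.
by rewrite e; have := h' j; lia.
Qed.

Lemma brick_bounded (J : finType) (z z' : J -> int) j :
  brick z = brick z' -> `|z j - z' j| <= #|J|%:Z.
Proof.
move=> [e /ffunP /(_ j)]; rewrite !ffunE e.
set M := (#|J|.+1)%:Z; set c := (brick_colour z')%:Z => ke.
have := divz_eq (z j - c) M; have := divz_eq (z' j - c) M.
have M0 : M != 0 by [].
have := modz_ge0 (z j - c) M0; have := modz_ge0 (z' j - c) M0.
have := ltz_pmod (z j - c) (isT : 0 < M); have := ltz_pmod (z' j - c) (isT : 0 < M).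
by rewrite ke; set w := (_ * M); rewrite /M; lia.
Qed.

(** * Continuous maps to lower dimension are not injective *)

(* Applied with (g, h) being the distance of the images and of the points, in both
   orders, this gives uniform continuity of an injective map and of its inverse. *)
Lemma compact_modulus (R : realType) (T : topologicalType) (L : set T) (g h : T -> R) :
  compact L -> (forall z, L z -> {for z, continuous g}) ->
  (forall z, L z -> {for z, continuous h}) ->
  (forall z, 0 <= g z) -> (forall z, L z -> g z = 0 -> h z = 0) ->
  forall eta, 0 < eta -> exists2 del, 0 < del & forall z, L z -> g z < del -> h z < eta.
Proof.
move=> cL cg ch g0 gh eta eta0.
have [->|/set0P L0] := eqVneq L set0; first by exists 1.
(* [k] is positive on [L], and its minimum serves as [del]. *)
pose k z := g z + Num.max 0 (eta - h z).
have ck : {within L, continuous k}.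
  apply: continuous_in_subspaceT => z; rewrite inE => Lz.
  apply: (@cvgD R R^o); first exact: cg.
  apply: (@continuous_max _ _ (fun=> 0) (fun z => eta - h z)).
    exact: cst_continuous.
  by apply: (@cvgB R R^o); [exact: cvg_cst|exact: ch].
have [z0 z0L kmin] := compact_EVT_min L0 cL ck.
exists (k z0); last first.
  move=> z Lz gk; have := kmin z (mem_set Lz); rewrite leNgt => kz.
  rewrite ltNge; apply: contra kz => hz.
  by rewrite [k z]/k max_l ?addr0 // subr_le0.
have max0 : 0 <= Num.max 0 (eta - h z0) by rewrite le_max lexx.
(* If [k z0] were 0, then [g z0] and hence [h z0] would vanish, and the second term of [k z0] would
   be [eta]. *)
rewrite lt_neqAle addr_ge0 // andbT eq_sym paddr_eq0 //; apply/negP => /andP [/eqP gz0].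
rewrite (gh z0) ?subr0 //; last by rewrite -inE.
by rewrite max_r ?ltW // gt_eqF.
Qed.

Lemma floor_close (R : realType) (u v : R) : u < v + 1 -> Num.floor u <= Num.floor v + 1.
Proof.
move=> uv; rewrite -ltzD1 floor_lt_int (lt_trans uv) // intrD ltrD2r.
exact: floorD1_gt.
Qed.

Lemma floor_bounded (R : realType) (u v : R) (m : nat) :
  `|Num.floor u - Num.floor v| <= m%:Z -> `|u - v| < m.+1%:R.
Proof.
rewrite -(ler_int R) intr_norm intrB => h.
have := floor_itv u; have := floor_itv v; rewrite !intrD => /andP [v1 v2] /andP [u1 u2].
move: h; rewrite ler_norml ltr_norml -[m.+1]addn1 natrD -pmulrn => /andP [h1 h2].
by apply/andP; split; lra.
Qed.

Section DistanceSum.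
Variables (R : realType) (T : topologicalType) (K : finType) (F : K -> T -> R).

(** A function on the product, so that compactness can be applied to pairs of points. *)
Definition dist_sum (z : T * T) : R := \sum_k `|F k z.1 - F k z.2|.

Lemma dist_sum_ge0 z : 0 <= dist_sum z.
Proof. by apply: sumr_ge0. Qed.

Lemma dist_sum_eq0 z : dist_sum z = 0 <-> forall k, F k z.1 = F k z.2.
Proof.
split=> [/eqP|h]; last by rewrite /dist_sum big1 // => k _; rewrite h subrr normr0.
rewrite psumr_eq0 // => /allP h k; apply/eqP.
by have := h k (mem_index_enum k); rewrite normr_eq0 subr_eq0.
Qed.

Lemma dist_sum_ge z k : `|F k z.1 - F k z.2| <= dist_sum z.
Proof. by rewrite /dist_sum (bigD1 k) //= lerDl sumr_ge0. Qed.

Lemma dist_sum_continuous z :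
  (forall k, {for z.1, continuous (F k)}) -> (forall k, {for z.2, continuous (F k)}) ->
  {for z, continuous dist_sum}.
Proof.
move=> c1 c2; apply: (@cvg_big R) => [|k _]; first exact: add_continuous.
apply: (@cvg_norm R R^o); apply: (@cvgB R R^o).
  by apply: (@cvg_comp _ _ _ fst (F k)); [exact: cvg_fst|exact: c1].
by apply: (@cvg_comp _ _ _ snd (F k)); [exact: cvg_snd|exact: c2].
Qed.
End DistanceSum.

Lemma box_compact (R : realType) (D : nat) (a b : 'I_D -> R) :
  compact [set v : 'rV[R]_D | forall i, `[a i, b i]%classic (v 0 i)].
Proof.
have compact_box := @rV_compact R D (fun i => `[a i, b i]%classic).
by apply: compact_box => i; exact: segment_compact.
Qed.

Lemma no_injection_lower_dim (R : realType) (D : nat) (J : finType)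
    (f : J -> 'rV[R]_D -> R) (U : set 'rV[R]_D) :
  open U -> U !=set0 -> (forall j x, U x -> {for x, continuous (f j)}) ->
  (#|J| < D)%N ->
  exists x y, [/\ U x, U y, x <> y & forall j, f j x = f j y].
Proof.
move=> oU [a Ua] cf JD; apply: contrapT => noinj.
have {noinj} inj x y : U x -> U y -> (forall j, f j x = f j y) -> x = y.
  by move=> Ux Uy e; apply: contrapT => xy; apply: noinj; exists x, y.
have [e e0 aeU] : exists2 e : R, 0 < e &
    forall v : 'rV[R]_D, (forall i, a 0 i <= v 0 i <= a 0 i + e) -> U v.
  have /nbhs_ballP [e /= e0 aeU] : nbhs a U by apply: open_nbhs_nbhs.
  exists (e / 2); first by rewrite divr_gt0.
  move=> v vP; apply: aeU; split=> // i j; rewrite !ord1 /ball /= ltr_norml.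
  by have := vP j; lra.
pose K := [set v : 'rV[R]_D | forall i, `[a 0 i, a 0 i + e]%classic (v 0 i)].
have KU v : K v -> U v.
  by move=> Kv; apply: aeU => i; have := Kv i; rewrite /= in_itv.
have cK : compact K := @box_compact _ _ _ _.
have cL := compact_setX cK cK.
pose g := dist_sum f; pose h := dist_sum (fun (i : 'I_D) (v : 'rV[R]_D) => v 0 i).
have cg z : (K `*` K) z -> {for z, continuous g}.
  by case=> K1 K2; apply: dist_sum_continuous => j; apply: cf; exact: KU.
have ch z : (K `*` K) z -> {for z, continuous h}.
  by move=> _; apply: dist_sum_continuous => i; exact: coord_continuous.
have gh z : (K `*` K) z -> g z = 0 -> h z = 0.
  case=> K1 K2 /dist_sum_eq0 e12; apply/dist_sum_eq0 => i.
  by rewrite (inj _ _ (KU _ K1) (KU _ K2) e12).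
have hg z : (K `*` K) z -> h z = 0 -> g z = 0.
  move=> _ /dist_sum_eq0 e12; apply/dist_sum_eq0 => i; congr (f i _).
  by apply/rowP.
have modgh := compact_modulus cL cg ch (dist_sum_ge0 _) gh.
have modhg := compact_modulus cL ch cg (dist_sum_ge0 _) hg.
pose n := D.+1; pose M : nat := #|J|.+1.
have n0 : 0 < n%:R :> R by rewrite ltr0n.
have M0 : 0 < M%:R :> R by rewrite ltr0n.
(* The distance [e / (n + n)] amounts to [B] steps of the grid of mesh [e / N] chosen below. *)
have [|del del0 delP] := modgh (e / (n%:R + n%:R)); first by rewrite divr_gt0 ?addr_gt0.
(* At this scale, images in one brick differ by at most [M / s] in each of fewer than [M]
   coordinates, hence by less than [del] in total. *)
pose s : R := M%:R ^+ 2 / del.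
have s0 : 0 < s by rewrite divr_gt0 ?exprn_gt0.
(* For points within [eta], the scaled image coordinates differ by less than 1, so their floors by
   at most 1. *)
have [|eta eta0 etaP] := modhg (s^-1); first by rewrite invr_gt0.
(* The second term makes [n] grid steps in every coordinate shorter than [eta]; the first gives
   [n * (n + n + B) < N]. *)
pose B : nat := ((n + n).+1 + Num.bound (D%:R * e / eta))%N.
have B0 : 0 < B%:R :> R by rewrite ltr0n.
have Bbig : D%:R * e / eta < B%:R.
  rewrite natrD (lt_le_trans (archi_boundP _)) ?lerDr //.
  by rewrite divr_ge0 ?mulr_ge0 // ltW.
pose N : nat := ((n + n) * B)%N.
have N0 : 0 < N%:R :> R by rewrite ltr0n.
pose X := grid_simplex 'I_D.+1 N.
(* The coordinate [ord0] is determined by the others, which embed the grid into the cube [K]. *)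
pose p (x : X) : 'rV[R]_D :=
  \row_i (a 0 i + e * ((grid_coord x (lift ord0 i))%:R / N%:R)).
have pK x : K (p x).
  move=> i; rewrite /= in_itv /= mxE.
  pose c : R := (grid_coord x (lift ord0 i))%:R / N%:R; rewrite -/c.
  have /andP [c0 c1] : 0 <= c <= 1.
    apply/andP; split; first exact: divr_ge0.
    by rewrite ler_pdivrMr // mul1r ler_nat -ltnS ltn_ord.
  by rewrite lerDl mulr_ge0 ?lerD2l ?ler_piMr // ltW.
have hp x y : h (p x, p y) = e / N%:R *
    \sum_(i < D) `|(grid_coord x (lift ord0 i))%:R - (grid_coord y (lift ord0 i))%:R|.
  rewrite /h /dist_sum mulr_sumr; apply: eq_bigr => i _ /=; rewrite !mxE.
  rewrite -[X in X * `|_|]gtr0_norm ?divr_gt0 // -normrM; congr `|_|.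
  by field; rewrite gt_eqF.
pose cls (x : X) := brick (fun j => Num.floor (s * f j (p x))).
apply: (@lebesgue_grid 'I_D.+1 N M B _ cls fst _ _ _ _ _ ord0).
- by rewrite card_ord ltnS (leq_ltn_trans (leq0n _) JD).
- by rewrite card_ord.
- rewrite card_ord -/n => x y xy yx; have gs : g (p x, p y) < s^-1.
    apply: etaP; first by split; exact: pK.
    have le i : `|(grid_coord x i)%:R - (grid_coord y i)%:R| <= n%:R :> R.
      have := xy i; have := yx i; rewrite -!(ler_nat R) !natrD ler_norml.
      by move=> h1 h2; apply/andP; split; lra.
    rewrite hp; apply: (@le_lt_trans _ _ (e / N%:R * (D%:R * n%:R))).
      rewrite ler_pM2l ?divr_gt0 // -[X in X%:R * _](card_ord D) mulrC mulr_natr.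
      by rewrite -sumr_const; apply: ler_sum => i _; exact: le.
    rewrite natrM natrD.
    have -> : e / ((n%:R + n%:R) * B%:R) * (D%:R * n%:R) = D%:R * e / (2 * B%:R).
      move: (n%:R) (B%:R) n0 B0 => x' y' x0 y0; field.
      by rewrite !gt_eqF ?addr_gt0.
    rewrite ltr_pdivrMr ?mulr_gt0 //.
    move: Bbig; rewrite ltr_pdivrMr // => Bbig; apply: (lt_le_trans Bbig).
    by rewrite [leRHS]mulrC ler_pM2r // ler_peMl ?ler1n // ltW.
  have close j : `|s * f j (p x) - s * f j (p y)| < 1.
    rewrite -mulrBr normrM gtr0_norm // mulrC -ltr_pdivlMr // div1r.
    exact: le_lt_trans (dist_sum_ge f (p x, p y) j) gs.
  by apply: brick_close => j; apply: floor_close; move: (close j);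
    rewrite ltr_norml => /andP [h1 h2]; lra.
- move=> x y cxy.
  have gd : g (p x, p y) < del.
    have le j : `|f j (p x) - f j (p y)| <= M%:R / s.
      rewrite ler_pdivlMr // mulrC -{1}(gtr0_norm s0) -normrM mulrBr ltW //.
      by apply: floor_bounded; apply: (brick_bounded j cxy).
    apply: (@le_lt_trans _ _ (#|J|%:R * (M%:R / s))).
      by rewrite mulrC mulr_natr -sumr_const; apply: ler_sum => j _; exact: le.
    have -> : del = M%:R * (M%:R / s).
      by rewrite /s; move: (M%:R) M0 => x' x0; field; rewrite !gt_eqF.
    by rewrite ltr_pM2r ?(divr_gt0 M0 s0) // ltr_nat.
  have := delP (p x, p y) (conj (pK x) (pK y)) gd; rewrite hp.
  set S := \sum_(i < D) _ => hS.
  have SB : S < B%:R.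
    move: hS; rewrite natrM natrD.
    have -> : e / ((n%:R + n%:R) * B%:R) * S = e / (n%:R + n%:R) * (S / B%:R).
      by move: (n%:R) (B%:R) n0 B0 => x' y' x0 y0; field; rewrite !gt_eqF ?addr_gt0.
    by rewrite gtr_pMr ?divr_gt0 ?addr_gt0 // ltr_pdivrMr // mul1r.
  have le i : `|(grid_coord x i)%:R - (grid_coord y i)%:R| <= S.
    (* The coordinate [ord0] is [N] minus the others, so its change is also at most [S]. *)
    have [->|[i' ->]] : i = ord0 \/ exists i' : 'I_D, i = lift ord0 i'.
      by case: (unliftP ord0 i) => [i' ->|->]; [right; exists i'|left].
      have tot (z : X) : (grid_coord z ord0)%:R =
          N%:R - \sum_(i < D) (grid_coord z (lift ord0 i))%:R :> R.
        have /(congr1 (GRing.natmul (1 : R))) := grid_coord_sum z.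
        by rewrite big_ord_recl natrD natr_sum => /(canRL (addrK _)).
      rewrite !tot opprB addrCA addrAC subrr add0r -sumrB.
      apply: le_trans (ler_norm_sum _ _ _) _.
      by apply: ler_sum => k _; rewrite distrC.
    by rewrite /S (bigD1 i') //= lerDl sumr_ge0.
  move=> i; rewrite -(ler_nat R) natrD -lerBlDl.
  by apply: le_trans (ler_norm _) _; apply: le_trans (le i) (ltW SB).
- rewrite card_ord -/n (mulnDr n (n + n) B) [N]mulnDl addnC ltn_add2l.
  by rewrite ltn_pmul2l // leq_addr.
Qed.

(** * Region probabilities *)

Lemma sum_prod_dffun (R : comPzSemiRingType) (I : finType) (T_ : I -> finType)
    (F : forall i, T_ i -> R) :
  \sum_(s : {dffun forall i, T_ i}) \prod_i F i (s i) = \prod_i \sum_(x : T_ i) F i x.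
Proof.
pose P i := [ffun x => F i x].
rewrite (reindex (@dffun_of_fprod I T_)) /=; last first.
  exact/onW_bij/dffun_of_fprod_bij.
transitivity (\sum_(t : fprod T_) \prod_(i in I) P i (t i)).
  by apply: eq_bigr => t _; apply: eq_bigr => i _; rewrite !ffunE.
rewrite big_fprod -(bigA_distr_big_dep _ (fun i j => untag 0 (P i) j)).
apply: eq_bigr => i _; rewrite -(big_tag (fun i => P i)).
by apply: eq_bigr => x _; rewrite ffunE.
Qed.

(** Setting the factor [k] to zero off [x] turns the restricted sum into a full one, where all other
    factors sum to 1. *)
Lemma sum_prod_dffun_marginal (R : comPzSemiRingType) (I : finType) (T_ : I -> finType)
    (F : forall i, T_ i -> R) (k : I) (x : T_ k) :
  (forall i, \sum_(y : T_ i) F i y = 1) ->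
  \sum_(s : {dffun forall i, T_ i} | s k == x) \prod_i F i (s i) = F k x.
Proof.
move=> F1.
(* The types of [y] and [x] agree only when [i = k], hence the comparison of tagged values. *)
pose G i (y : T_ i) := if (i == k) && (Tagged T_ y != Tagged T_ x) then 0 else F i y.
transitivity (\sum_(s : {dffun forall i, T_ i}) \prod_i G i (s i)).
  rewrite big_mkcond; apply: eq_bigr => s _; have [skx|skx] := eqVneq.
    apply: eq_bigr => i _; rewrite /G; have [ik|//] := eqVneq i k.
    by subst i; rewrite skx eqxx.
  rewrite (bigD1 k) //= {1}/G eqxx /= ifT ?mul0r //.
  by rewrite -tag_eqE /tag_eq eqxx /= tagged_asE.
rewrite sum_prod_dffun (bigD1 k) //= [X in _ * X]big1 ?mulr1 => [|i ik].
  rewrite (bigD1 x) //= big1 ?addr0 => [|y yx]; first by rewrite /G eqxx eqxx.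
  by rewrite /G eqxx /= ifT // -tag_eqE /tag_eq eqxx /= tagged_asE.
by rewrite -(F1 i); apply: eq_bigr => y _; rewrite /G (negbTE ik).
Qed.

Lemma sum_probability_partition (R : realType) (d : measure_display) (T : measurableType d)
    (P : probability T R) (n : nat) (I : 'I_n -> set T) :
  (forall r, measurable (I r)) -> (forall r r', r != r' -> I r `&` I r' = set0) ->
  (forall x, exists r, I r x) -> \sum_(r < n) fine (P (I r)) = 1.
Proof.
move=> mI dI cI; apply: EFin_inj; rewrite -sumEFin -(@probability_setT _ _ _ P).
transitivity (\sum_(r < n) P (I r))%E.
  by apply: eq_bigr => r _; rewrite fineK // fin_num_measure.
rewrite -(measure_bigsetU_ord P predT) //; last first.
  apply/trivIsetP => r r' _ _; exact: dI.
congr (P _); apply/seteqP; split=> x // _.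
by have [r Irx] := cI x; rewrite (bigD1 r) //=; left.
Qed.

(** * Directions annihilated by differentials *)

Section DirectionalCriticality.
Variables (R : realType) (V : normedModType R) (x v : V).

(** Closure under ring operations carries a direction that kills the free probabilities over to
    every [q]. *)
Definition critical (f : V -> R) : Prop := differentiable f x /\ 'd f x v = 0.

Lemma critical_cst a : critical (cst a).
Proof. by split; [exact: differentiable_cst|rewrite diff_cst]. Qed.

Lemma criticalD f g : critical f -> critical g -> critical (f + g).
Proof.
by move=> [df f0] [dg g0]; split; [exact: differentiableD|rewrite diffD //= f0 g0 addr0].
Qed.

Lemma criticalN f : critical f -> critical (- f).
Proof. by move=> [df f0]; split; [exact: differentiableN|rewrite diffN // fctE f0 oppr0]. Qed.

Lemma criticalM f g : critical f -> critical g -> critical (f * g).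
Proof.
move=> [df f0] [dg g0]; split; first exact: differentiableM.
rewrite diffM // -[LHS]/(f x * 'd g x v + g x * 'd f x v).
by rewrite f0 g0 !mulr0 addr0.
Qed.

Lemma critical_sum (K : Type) (r : seq K) (P : pred K) (F : K -> V -> R) :
  (forall k, P k -> critical (F k)) -> critical (\sum_(k <- r | P k) F k).
Proof. by move=> H; apply: big_ind => //; [exact: critical_cst|exact: criticalD]. Qed.

Lemma critical_prod (K : Type) (r : seq K) (P : pred K) (F : K -> V -> R) :
  (forall k, P k -> critical (F k)) -> critical (\prod_(k <- r | P k) F k).
Proof. by move=> H; apply: big_ind => //; [exact: critical_cst|exact: criticalM]. Qed.
End DirectionalCriticality.

(** The matrix of partial derivatives has more rows than columns, hence a nonzero left kernel
    vector. *)
Lemma common_critical_direction (R : realType) (D : nat) (J : finType)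
    (f : J -> 'rV[R]_D -> R) (x : 'rV[R]_D) :
  (#|J| < D)%N -> (forall j, differentiable (f j) x) ->
  exists2 v, v != 0 & forall j, critical x v (f j).
Proof.
move=> JD df.
pose A : 'M[R]_(D, #|J|) := \matrix_(i, k) 'd (f (enum_val k)) x (delta_mx 0 i).
have /rowV0Pn [v /sub_kermxP vA v0] : kermx A != 0.
  rewrite -mxrank_eq0 mxrank_ker -lt0n subn_gt0.
  exact: leq_ltn_trans (rank_leq_col A) JD.
exists v => // j; split => //.
have /rowP /(_ (enum_rank j)) := vA; rewrite !mxE => <-.
rewrite [in LHS](row_sum_delta v) linear_sum; apply: eq_bigr => i _.
by rewrite mxE enum_rankK linearZ.
Qed.

(** A form of [big_ord_recr] for an [n] that is a successor only by an equation, as [Rl t] will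
    be. *)
Lemma sum_ord_widen (V : nmodType) (m n : nat) (le_mn : (m <= n)%N) (F : 'I_n -> V)
    (r : 'I_n) :
  n = m.+1 -> r = m :> nat -> \sum_i F i = \sum_(i < m) F (widen_ord le_mn i) + F r.
Proof.
move=> nm rm; subst n; rewrite big_ord_recr /=; congr (_ + F _); last exact: val_inj.
by apply: eq_bigr => i _; congr F; exact: val_inj.
Qed.

Lemma continuous_at_sum (R : realType) (V : topologicalType) (K : finType) (A : pred K)
    (F : K -> V -> R) (x : V) :
  (forall k, {for x, continuous (F k)}) ->
  {for x, continuous (fun y => \sum_(k | A k) F k y)}.
Proof.
by move=> cF; apply: (@cvg_big R) => [|k _]; [exact: add_continuous|exact: cF].
Qed.

(** * The quantized system *)

Section Quantized.
Variables (R : realType) (D N : nat) (L : 'I_N -> nat) (W : nat) (T : 'I_W -> nat)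
  (grp : forall j : 'I_N, 'I_(L j) -> 'I_W)
  (sub : forall (j : 'I_N) (l : 'I_(L j)), 'I_(T (grp l)))
  (Rl : forall w : 'I_W, 'I_(T w) -> nat)
  (d : 'I_W -> measure_display) (X : forall w, measurableType (d w))
  (P : forall w : 'I_W, 'rV[R]_D -> probability (X w) R)
  (I : forall (w : 'I_W) (t : 'I_(T w)), 'I_(Rl t) -> set (X w)).
Hypothesis grouping : grouping_ok sub.
Hypothesis quantizers : quantizers_ok I.

Definition region_prob (w : 'I_W) (t : 'I_(T w)) (r : 'I_(Rl t)) (theta : 'rV[R]_D) : R :=
  fine (P w theta (I r)).

Lemma sum_region_prob w (t : 'I_(T w)) theta : \sum_r region_prob (t := t) r theta = 1.
Proof. by have [mI [dI cI]] := quantizers t; exact: sum_probability_partition. Qed.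

(** Regularity is assumed of the [q] only; this transfers it to region probabilities. As subgroups
    are nonempty, some subvector uses the quantizer, and summing out the other entries of its sensor
    leaves the region probability. *)
Lemma region_prob_marginal w (t : 'I_(T w)) (r : 'I_(Rl t)) :
  exists j (A : pred (sensor_out sub Rl j)), region_prob r = \sum_(s | A s) q P I s.
Proof.
have [j [l [lw lt]]] := grouping.2.2 w t; subst w.
have {}lt : sub l = t by exact: val_inj.
subst t; exists j, (fun s : sensor_out sub Rl j => s l == r).
apply/funext => theta; rewrite fct_sumE.
pose F (i : 'I_(L j)) (x : 'I_(Rl (sub i))) := region_prob x theta.
rewrite -[LHS]/(F l r) -(@sum_prod_dffun_marginal _ _ _ F) // => i.
exact: sum_region_prob.
Qed.

Definition free_level := {w : 'I_W & {t : 'I_(T w) & 'I_(Rl t - 1)}}.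

Lemma card_free_level : #|{: free_level}| = lambda_ISM Rl.
Proof.
rewrite card_tagged sumnE big_map big_enum; apply: eq_bigr => w _.
rewrite card_tagged sumnE big_map big_enum; apply: eq_bigr => t _.
by rewrite card_ord.
Qed.

Definition free_prob (k : free_level) : 'rV[R]_D -> R :=
  region_prob (widen_ord (leq_subr 1 _) (tagged (tagged k))).

Lemma region_prob_last w (t : 'I_(T w)) (r : 'I_(Rl t)) :
  (exists k, region_prob r = free_prob k) \/
  region_prob r = cst 1 - \sum_(r' : 'I_(Rl t - 1)) free_prob (existT _ w (existT _ t r')).
Proof.
have [rlt|rge] := ltnP r (Rl t - 1).
  left; exists (existT _ w (existT _ t (Ordinal rlt))).
  by congr region_prob; exact: val_inj.
(* The level [r] exists, so [Rl t] is positive and the truncated subtraction is exact. *)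
have Rl1 : Rl t = (Rl t - 1).+1 by have := ltn_ord r; lia.
have rl : r = (Rl t - 1)%N :> nat by have := ltn_ord r; lia.
right; apply/funext => theta; rewrite !fctE fct_sumE -(sum_region_prob t theta).
rewrite [X in X - _](sum_ord_widen (leq_subr 1 _) (fun r' => region_prob r' theta) Rl1 rl).
by rewrite addrC addKr.
Qed.

Lemma obs_equiv_free_prob theta theta' :
  (forall k, free_prob k theta = free_prob k theta') -> obs_equiv sub P I theta theta'.
Proof.
move=> e u; apply: eq_bigr => j _; apply: eq_bigr => l _.
rewrite -[LHS]/(region_prob _ theta) -[RHS]/(region_prob _ theta').
have [[k ->]|->] := region_prob_last (u j l); first exact: e.
by rewrite !fctE !fct_sumE; congr (_ - _); apply: eq_bigr.
Qed.

(** Each summand of [v *m FIM] contains the derivative of some [q] along [v], which is 0 whatever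
    the value of the inverse of [q]. *)
Lemma FIM_singular theta :
  (forall j (s : sensor_out sub Rl j), differentiable (q P I s) theta) ->
  (lambda_ISM Rl < D)%N -> \det (FIM sub P I theta) = 0.
Proof.
move=> dq lamD.
have dp w (t : 'I_(T w)) (r : 'I_(Rl t)) : differentiable (region_prob r) theta.
  have [j [A ->]] := region_prob_marginal r.
  apply: (big_ind (fun f : _ -> R => differentiable f theta)) => [|f g|s _].
  - exact: differentiable_cst.
  - exact: differentiableD.
  - exact: dq.
have [||v v0 vp] := @common_critical_direction R D free_level free_prob theta.
- by rewrite card_free_level.
- by move=> k; exact: dp.
have crit_p w (t : 'I_(T w)) (r : 'I_(Rl t)) : critical theta v (region_prob r).
  have [[k ->]|->] := region_prob_last r; first exact: vp.
  apply: criticalD; first exact: critical_cst.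
  by apply: criticalN; apply: critical_sum.
have crit_q j (s : sensor_out sub Rl j) : critical theta v (q P I s).
  have -> : q P I s = \prod_(l < L j) region_prob (s l).
    by apply/funext => th; rewrite fct_prodE.
  exact: critical_prod.
apply/eqP/det0P; exists v => //; apply/rowP => b; rewrite !mxE.
have grad j (s : sensor_out sub Rl j) :
    \sum_a v 0 a * partial a (q P I s) theta = 0.
  rewrite -[RHS](crit_q j s).2 [in RHS](row_sum_delta v) linear_sum.
  apply: eq_bigr => a _.
  by rewrite linearZ /= -deriveE.
under eq_bigr do rewrite mxE big_distrr /=.
rewrite exchange_big big1 //= => j _.
under eq_bigr do rewrite big_distrr /=.
rewrite exchange_big big1 //= => s _.
rewrite (eq_bigr (fun a => v 0 a * partial a (q P I s) theta *
   ((q P I s theta)^-1 * partial b (q P I s) theta))); last first.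
  by move=> a _; rewrite -!mulrA; congr (_ * _); rewrite mulrCA.
by rewrite -big_distrl /= grad mul0r.
Qed.

(** The two points witness each other's nonidentifiability; both are returned because the infinitude
    argument needs two distinct ones. *)
Lemma nonidentifiable_pair (Theta U : set 'rV[R]_D) :
  open U -> U !=set0 -> U `<=` Theta ->
  (forall j (s : sensor_out sub Rl j), {within Theta, continuous (q P I s)}) ->
  (lambda_ISM Rl < D)%N ->
  exists x y, [/\ U x, U y, x <> y, ~ identifiable_pt sub P I Theta x &
    ~ identifiable_pt sub P I Theta y].
Proof.
move=> oU U0 UTheta cq lamD.
have cqU j (s : sensor_out sub Rl j) x : U x -> {for x, continuous (q P I s)}.
  have := continuous_subspaceW UTheta (cq j s).
  by rewrite continuous_open_subspace // => cU Ux; apply: cU; rewrite inE.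
have cp k x : U x -> {for x, continuous (free_prob k)}.
  move=> Ux; have [j [A e]] :=
    region_prob_marginal (widen_ord (leq_subr 1 _) (tagged (tagged k))).
  have -> : free_prob k = fun th => \sum_(s | A s) q P I s th.
    by apply/funext => th; rewrite /free_prob e fct_sumE.
  by apply: continuous_at_sum => s; exact: cqU.
have [x [y [Ux Uy xy e]]] := no_injection_lower_dim oU U0 cp
  (eq_ind_r (fun n => (n < D)%N) lamD card_free_level).
exists x, y; split => //.
  move=> /(_ y (UTheta _ Uy)); apply; first exact: nesym.
  exact: obs_equiv_free_prob.
move=> /(_ x (UTheta _ Ux)); apply => //.
by apply: obs_equiv_free_prob => k; rewrite e.
Qed.
End Quantized.

Theorem theorem5 (R : realType) (D N : nat) (L : 'I_N -> nat) (W : nat)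
  (T : 'I_W -> nat)
  (grp : forall j : 'I_N, 'I_(L j) -> 'I_W)
  (sub : forall (j : 'I_N) (l : 'I_(L j)), 'I_(T (grp j l)))
  (Rl : forall w : 'I_W, 'I_(T w) -> nat)
  (d : 'I_W -> measure_display) (X : forall w, measurableType (d w))
  (P : forall w : 'I_W, 'rV[R]_D -> probability (X w) R)
  (I : forall (w : 'I_W) (t : 'I_(T w)), 'I_(Rl w t) -> set (X w))
  (Theta : set 'rV[R]_D) :
  grouping_ok sub ->
  quantizers_ok I ->
  (* (i) *)
  ((Theta° !=set0) ->
   (forall (j : 'I_N) (s : sensor_out sub Rl j) (theta : 'rV[R]_D), Theta theta ->
      differentiable (q P I s) theta /\
      forall i : 'I_D, differentiable (partial i (q P I s)) theta) ->
   (lambda_ISM Rl < D)%N ->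
   forall theta, Theta theta -> \det (FIM sub P I theta) = 0)
  /\
  (* (ii) *)
  ((Theta° !=set0) ->
   (forall (j : 'I_N) (s : sensor_out sub Rl j), {within Theta, continuous (q P I s)}) ->
   (lambda_ISM Rl < D)%N ->
   ~ identifiable sub P I Theta /\
   forall U : set 'rV[R]_D, open U -> U `<=` Theta -> (U !=set0) ->
     infinite_set [set theta | U theta /\ ~ identifiable_pt sub P I Theta theta]).
Proof.
move=> grouping quantizers; split.
  move=> _ dq lamD theta th; apply: FIM_singular => // j s.
  by have [] := dq j s theta th.
move=> Theta0 cq lamD.
have pair := fun U oU U0 UT =>
  nonidentifiable_pair (U := U) grouping quantizers oU U0 UT cq lamD.
split.
  have [x [_ [Tx _ _ nid _]]] := pair _ (@open_interior _ Theta) Theta0 (@interior_subset _ _).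
  by move=> id; apply: nid; apply: id; exact: interior_subset.
move=> U oU UT [a Ua]; set S := [set theta | _] => finS.
(* Only [a] is kept among the finitely many nonidentifiable points, so that [V] is
   visibly nonempty. *)
pose V := U `&` ~` (S `\ a).
have oV : open V.
  apply: openI => //; apply: closed_openC.
  have /hausdorff_accessible := @norm_hausdorff R 'rV[R]_D.
  by rewrite accessible_finite_set_closed; apply; exact: finite_setD.
have [||x [y [[Ux Sx] [Uy Sy] xy nx ny]]] := pair _ oV.
- by exists a; split => // -[_]; apply.
- by move=> z [/UT].
(* Both points are nonidentifiable and so belong to [S], of which [V] keeps at most [a]. *)
have xa : x = a by apply: contrapT => xa; apply: Sx.
have ya : y = a by apply: contrapT => ya; apply: Sy.
by apply: xy; rewrite xa ya.
Qed.
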